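(* Let $\Sigma: x^+=Ax+Bu$ be a discrete-time linear system without disturbances, with $A$ nilpotent, and let the safe set $S_{xu}\subset\mathbb{R}^n\times\mathbb{R}^m$ be a polytope. If the interior of $S_{xu}$ contains a fixed point of $\Sigma$ (a pair $(x,u)$ with $Ax+Bu=x$), then for any integer $\lambda>0$ the set $\mathcal{C}_{x,(\tau,\lambda)}$ converges to the Maximal controlled invariant set $\mathcal{C}_{\max}$ of $\Sigma$ within $S_{xu}$ in Hausdorff distance exponentially fast as $\tau$ increases; that is, there exist $c>0$, $a\in(0,1)$ and $\tau_0\in\mathbb{N}$ such that $d(\mathcal{C}_{x,(\tau,\lambda)},\mathcal{C}_{\max})\le c\,a^\tau$ for all integers $\tau\ge\tau_0$.
   Context: Setting: $x\in\mathbb{R}^n$, $u\in\mathbb{R}^m$; $A\in\mathbb{R}^{n\times n}$, $B\in\mathbb{R}^{n\times m}$. A polytope is a bounded set of the form $\{z\mid Gz\le f\}$. $d$ is the Hausdorff distance induced by the Euclidean norm; $\pi_n$ is the projection onto the first $n$ coordinates. A controlled invariant set (CIS) of $\Sigma$ within $S_{xu}$ is a set $\mathcal{C}\subseteq\mathbb{R}^n$ such that for every $x\in\mathcal{C}$ there is $u\in\mathbb{R}^m$ with $(x,u)\in S_{xu}$ and $Ax+Bu\in\mathcal{C}$; $\mathcal{C}_{\max}$ is the largest such set. $(\tau,\lambda)$-lasso matrices: for $\tau\in\mathbb{N}\cup\{0\}$, $\lambda\in\mathbb{N}$, $q=\tau+\lambda$, let $P=\mathrm{blkdiag}(\bar P,\dots,\bar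 P)\in\mathbb{R}^{mq\times mq}$ and $H=\mathrm{blkdiag}(\bar H,\dots,\bar H)\in\mathbb{R}^{m\times mq}$, with $m$ blocks each, where $\bar H=[1\ 0\ \cdots\ 0]\in\mathbb{R}^{1\times q}$ and $\bar P\in\mathbb{R}^{q\times q}$ has first $q-1$ rows $[\,0\ \ I_{q-1}]$ and last row with a single entry $1$ at position $\tau+1$ (positions counted from 1) and zeros elsewhere. $\mathcal{C}_{xv,(\tau,\lambda)}$ is the set of $(x,v)\in\mathbb{R}^n\times\mathbb{R}^{mq}$ such that, with $P,H$ the $(\tau,\lambda)$-lasso matrices, $u_t=HP^tv$, $x_0=x$ and $x_{t+1}=Ax_t+Bu_t$, one has $(x_t,u_t)\in S_{xu}$ for all $t\ge0$. $\mathcal{C}_{x,(\tau,\lambda)}=\pi_n(\mathcal{C}_{xv,(\tau,\lambda)})$. *)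

(* Defs.v *)
From mathcomp Require Import all_boot all_order all_algebra.
From mathcomp Require Import all_classical all_reals all_analysis.
Set Implicit Arguments.
Unset Strict Implicit.
Unset Printing Implicit Defensive.
Import Order.TTheory GRing.Theory Num.Theory.
Import numFieldNormedType.Exports.
Local Open Scope classical_set_scope.
Local Open Scope ring_scope.

(* The library norm on matrices is the sup norm, hence this definition. *)
Definition eucl_norm (R : realType) (n : nat) (x : 'cV[R]_n) : R :=
  Num.sqrt (\sum_(i < n) x i 0 ^+ 2).

(* Valued in \bar R: +oo when exactly one of the sets is empty or when a
   supremum is infinite. *)
Definition hausdorff_dist (R : realType) (n : nat) (X Y : set 'cV[R]_n)
    : \bar R :=
  maxe
    (ereal_sup [set ereal_inf [set (eucl_norm (x - y))%:E | y in Y] | x in X])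
    (ereal_sup [set ereal_inf [set (eucl_norm (x - y))%:E | x in X] | y in Y]).

Definition polytope (R : realType) (n : nat) (S : set 'cV[R]_n) : Prop :=
  bounded_set S /\
  exists (k : nat) (G : 'M[R]_(k, n)) (f : 'cV[R]_k),
    S = [set z | forall i : 'I_k, (G *m z) i 0 <= f i 0].

Definition nilpotent_mx (R : realType) (n : nat) (A : 'M[R]_n) : Prop :=
  exists k : nat, A ^+ k = 0.

(* A pair (x, u) in R^n x R^m is the stacked vector col_mx x u in R^(n+m). *)

Definition controlled_invariant (R : realType) (n m : nat)
    (A : 'M[R]_n) (B : 'M[R]_(n, m)) (Sxu : set 'cV[R]_(n + m))
    (C : set 'cV[R]_n) : Prop :=
  forall x, C x -> exists u : 'cV[R]_m,
    Sxu (col_mx x u) /\ C (A *m x + B *m u).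

(* The union of all controlled invariant sets; the two lemmas below show that
   it is the largest one. *)
Definition max_controlled_invariant (R : realType) (n m : nat)
    (A : 'M[R]_n) (B : 'M[R]_(n, m)) (Sxu : set 'cV[R]_(n + m))
    : set 'cV[R]_n :=
  \bigcup_(C in [set C | controlled_invariant A B Sxu C]) C.

Lemma max_controlled_invariant_cis (R : realType) (n m : nat)
    (A : 'M[R]_n) (B : 'M[R]_(n, m)) (Sxu : set 'cV[R]_(n + m)) :
  controlled_invariant A B Sxu (max_controlled_invariant A B Sxu).
Proof.
move=> x [C Cinv Cx]; have [u [Su CAB]] := Cinv x Cx.
by exists u; split=> //; exists C.
Qed.

Lemma max_controlled_invariant_largest (R : realType) (n m : nat)
    (A : 'M[R]_n) (B : 'M[R]_(n, m)) (Sxu : set 'cV[R]_(n + m))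
    (C : set 'cV[R]_n) :
  controlled_invariant A B Sxu C -> C `<=` max_controlled_invariant A B Sxu.
Proof. by move=> Cinv x Cx; exists C. Qed.

Lemma sum_ord_const (m p : nat) : (\sum_(i < m) p = m * p)%N.
Proof. by rewrite sum_nat_const card_ord. Qed.

(* blkdiag(M, ..., M) with m blocks; the library's \mxdiag only takes square
   blocks. *)
Definition blkdiag (R : realType) (m p q : nat) (M : 'M[R]_(p, q))
    : 'M[R]_(m * p, m * q) :=
  castmx (sum_ord_const m p, sum_ord_const m q)
    (\mxblock_(i < m, j < m) (if i == j then M else 0)).

(* Row i (from 0) of Pbar has its single 1 in column i+1 if i < q-1, and in
   column tau (position tau+1 counted from 1) if i = q-1. *)
Definition lasso_Pbar (R : realType) (tau lam : nat) : 'M[R]_(tau + lam) :=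
  \matrix_(i, j) (if (i.+1 < tau + lam)%N then (j == i.+1 :> nat)
                  else (j == tau :> nat))%:R.

Definition lasso_Hbar (R : realType) (tau lam : nat)
    : 'rV[R]_(tau + lam) :=
  \row_j (j == 0 :> nat)%:R.

Definition lasso_P (R : realType) (m tau lam : nat)
    : 'M[R]_(m * (tau + lam)) :=
  blkdiag m (lasso_Pbar R tau lam).

Definition lasso_H (R : realType) (m tau lam : nat)
    : 'M[R]_(m, m * (tau + lam)) :=
  castmx (muln1 m, erefl) (blkdiag m (lasso_Hbar R tau lam)).

Fixpoint trajectory (R : realType) (n m : nat) (A : 'M[R]_n)
    (B : 'M[R]_(n, m)) (x : 'cV[R]_n) (u : nat -> 'cV[R]_m) (t : nat)
    : 'cV[R]_n :=
  if t is t'.+1 then A *m trajectory A B x u t' + B *m u t' else x.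

Definition lasso_input (R : realType) (m tau lam : nat)
    (v : 'cV[R]_(m * (tau + lam))) (t : nat) : 'cV[R]_m :=
  lasso_H R m tau lam *m lasso_P R m tau lam ^+ t *m v.

Definition lasso_Cxv (R : realType) (n m : nat) (A : 'M[R]_n)
    (B : 'M[R]_(n, m)) (Sxu : set 'cV[R]_(n + m)) (tau lam : nat)
    : set 'cV[R]_(n + m * (tau + lam)) :=
  [set z | forall t : nat,
    let u := lasso_input (dsubmx z) in
    Sxu (col_mx (trajectory A B (usubmx z) u t) (u t))].
Arguments lasso_Cxv {R n m} A B Sxu tau lam _.

(* usubmx is the projection onto the first n coordinates. *)
Definition lasso_Cx (R : realType) (n m : nat) (A : 'M[R]_n)
    (B : 'M[R]_(n, m)) (Sxu : set 'cV[R]_(n + m)) (tau lam : nat)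
    : set 'cV[R]_n :=
  usubmx @` lasso_Cxv A B Sxu tau lam.

(* Main.v *)
Require Import Defs.
From mathcomp Require Import all_boot all_order all_algebra.
From mathcomp Require Import all_classical all_reals all_analysis.
From mathcomp Require Import ring lra zify.
Set Implicit Arguments.
Unset Strict Implicit.
Unset Printing Implicit Defensive.
Import Order.TTheory GRing.Theory Num.Theory.
Import numFieldNormedType.Exports.
Local Open Scope classical_set_scope.
Local Open Scope ring_scope.

(** Let (xe, ue) be a fixed point whose r-ball lies in Sxu. Any lasso-admissible
    point starts an infinite admissible trajectory, so the lasso set lies in
    the maximal controlled invariant set, and only the other half of the
    Hausdorff distance has to be estimated: each y in the maximal set must be
    close to a point of the lasso set.

    The point y starts some infinite admissible trajectory (x_t, u_t), whose
    input need not be eventually periodic. The idea is to fade it into the constant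
    input ue, with weights delta_t = a^(tau - t) (truncated subtraction) that
    grow from a^tau at time 0 to 1 at time tau and stay there. The faded input
    ue + (1 - delta_t) (u_t - ue) is constant from time tau on, hence is the
    input of a (tau, lam)-lasso for every lam > 0. It is applied from
    y' = xe + (1 - a^tau) (y - xe), which is within O(a^tau) of y.

    The pair (1 - delta_t) (x_t, u_t) + delta_t (xe, ue) belongs to Sxu with
    room delta_t r around it, by convexity. It is not quite the trajectory of
    the faded input: the states differ by an error e_t with e_0 = 0 and
    e_(t+1) = A e_t + (delta_(t+1) - delta_t) (x_(t+1) - xe)
    ([trajectory_blend]). As A is nilpotent, e_t is at most a constant L times
    the largest forcing term so far ([nilpotent_bounded_gain]); as
    delta_(s+1) - delta_s <= (1 - a) delta_(s+1) and delta is nondecreasing,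
    this is at most L D (1 - a) delta_t, where D bounds the distance from
    Sxu to the fixed point ([norm_blend_error]). So once a is close enough to 1
    that L D (1 - a) < r, the error fits in the available room at all times
    ([admissible_blend]), and the rate a does not depend on tau. *)

(** * Norm estimates *)

Lemma le_mx_norm (R : realType) (m n : nat) (M : 'M[R]_(m, n)) (b : R) :
  0 <= b -> (forall i j, `|M i j| <= b) -> `|M| <= b.
Proof.
move=> b0 Mb; rewrite [`|M|]mx_normrE.
by apply: bigmax_le => // -[i j] _; exact: Mb.
Qed.

Lemma mx_entry_le (R : realType) (m n : nat) (M : 'M[R]_(m, n)) i j :
  `|M i j| <= `|M|.
Proof.
by rewrite [leRHS]mx_normrE (le_bigmax _ (fun k => `|M k.1 k.2|) (i, j)).
Qed.

Lemma mx_norm_mulmx (R : realType) (m n : nat) (M : 'M[R]_(m, n))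
    (x : 'cV[R]_n) : `|M *m x| <= n%:R * `|M| * `|x|.
Proof.
apply: le_mx_norm => [|i j]; first by rewrite !mulr_ge0.
rewrite mxE (le_trans (ler_norm_sum _ _ _)) //.
have -> : n%:R * `|M| * `|x| = \sum_(k < n) (`|M| * `|x|).
  by rewrite sumr_const card_ord mulr_natl mulrnAl.
apply: ler_sum => k _; rewrite normrM ler_pM //; exact: mx_entry_le.
Qed.

Lemma norm_col_mx0 (R : realType) (m n : nat) (x : 'cV[R]_n) :
  `|col_mx x (0 : 'cV[R]_m)| <= `|x|.
Proof.
apply: le_mx_norm => // i j; rewrite -[i]fintype.splitK.
case: (fintype.split i) => k /=.
  by rewrite col_mxEu; exact: mx_entry_le.
by rewrite col_mxEd mxE normr0.
Qed.

Lemma norm_usubmx (R : realType) (m n : nat) (z : 'cV[R]_(n + m)) :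
  `|usubmx z| <= `|z|.
Proof. by apply: le_mx_norm => // i j; rewrite mxE; exact: mx_entry_le. Qed.

Lemma eucl_norm_le (R : realType) (n : nat) (x : 'cV[R]_n) :
  eucl_norm x <= n%:R * `|x|.
Proof.
have -> : n%:R * `|x| = Num.sqrt ((n%:R * `|x|) ^+ 2).
  by rewrite sqrtr_sqr ger0_norm // mulr_ge0.
(* The cruder factor n, in place of its square root, is enough here. *)
apply: ler_wsqrtr; apply: (@le_trans _ _ (\sum_(i < n) `|x| ^+ 2)).
  apply: ler_sum => i _; rewrite -[leLHS]real_normK ?num_real //.
  by rewrite lerXn2r ?nnegrE //; exact: mx_entry_le.
rewrite sumr_const card_ord exprMn -[leLHS]mulr_natl ler_wpM2r ?sqr_ge0 //.
by rewrite -natrX ler_nat -mulnn; case: (n) => // k; rewrite leq_pmull.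
Qed.

(** * Admissible inputs and the maximal controlled invariant set *)

Lemma trajectory_shift (R : realType) (n m : nat) (A : 'M[R]_n)
    (B : 'M[R]_(n, m)) (x : 'cV[R]_n) (u : nat -> 'cV[R]_m) (t : nat) :
  trajectory A B (A *m x + B *m u 0) (fun s => u s.+1) t =
  trajectory A B x u t.+1.
Proof. by elim: t => //= t ->. Qed.

Definition admissible (R : realType) (n m : nat) (A : 'M[R]_n)
    (B : 'M[R]_(n, m)) (Sxu : set 'cV[R]_(n + m)) (x : 'cV[R]_n)
    (u : nat -> 'cV[R]_m) : Prop :=
  forall t, Sxu (col_mx (trajectory A B x u t) (u t)).

(** One direction makes an infinite input out of a choice of feedback; the other
    holds because the points that have an admissible input form a controlled
    invariant set: dropping the first input leaves an admissible one. *)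
Lemma max_controlled_invariantP (R : realType) (n m : nat) (A : 'M[R]_n)
    (B : 'M[R]_(n, m)) (Sxu : set 'cV[R]_(n + m)) (x : 'cV[R]_n) :
  max_controlled_invariant A B Sxu x <-> exists u, admissible A B Sxu x u.
Proof.
split=> [[C Cinv Cx]|[u xu]]; last first.
  exists [set y | exists w, admissible A B Sxu y w]; last by exists u.
  move=> y [w yw]; exists (w 0%N); split; first exact: (yw 0%N).
  by exists (fun t => w t.+1) => t; rewrite trajectory_shift; exact: yw.
have /choice[f fP] : forall y, exists v : 'cV[R]_m,
    C y -> Sxu (col_mx y v) /\ C (A *m y + B *m v).
  move=> y; have [Cy|nCy] := pselect (C y); last by exists 0.
  by have [v vP] := Cinv y Cy; exists v.
pose X := fix X t := if t is s.+1 then A *m X s + B *m f (X s) else x.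
have XE t : trajectory A B x (f \o X) t = X t by elim: t => //= t ->.
have CX t : C (X t) by elim: t => //= t /fP[].
by exists (f \o X) => t; rewrite XE; have [] := fP _ (CX t).
Qed.

(** * Lasso inputs *)

Definition stack (R : realType) (m p : nat) (c : 'I_m -> 'cV[R]_p)
    : 'cV[R]_(m * p) :=
  castmx (sum_ord_const m p, erefl) (\mxcol_i c i).

Lemma blkdiag_mul_stack (R : realType) (m p q : nat) (M : 'M[R]_(p, q))
    (c : 'I_m -> 'cV[R]_q) :
  blkdiag m M *m stack c = stack (fun i => M *m c i).
Proof.
have castmx_mulmx a b d a' b' (ea : a = a') (eb : b = b')
    (X : 'M[R]_(a, b)) (Y : 'M[R]_(b, d)) :
    castmx (ea, eb) X *m castmx (eb, erefl) Y = castmx (ea, erefl) (X *m Y).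
  by case: a' / ea; case: b' / eb; rewrite !castmx_id.
rewrite /blkdiag /stack castmx_mulmx mxblockEv mxcol_mul; congr castmx.
apply: eq_mxcol => i; rewrite mul_mxrow_mxcol (bigD1 i) //= eqxx big1 ?addr0 //.
by move=> j; rewrite eq_sym => /negbTE ->; rewrite mul0mx.
Qed.

Lemma stack_unitE (R : realType) (m : nat) (c : 'I_m -> 'cV[R]_1) (i : 'I_m) :
  castmx (muln1 m, erefl) (stack c) i 0 = c i 0 0.
Proof.
rewrite /stack castmx_comp castmxE mxE /=.
set s := cast_ord _ i.
(* With blocks of size 1, position i is entry 0 of block i. *)
have -> : s = tagnat.Rank i (ord0 : 'I_1).
  apply: val_inj; rewrite [RHS]tagnat.RankEsum /=.
  by rewrite addn0 -(big_ord_widen m (fun=> 1%N)) 1?ltnW // sum1_card card_ord.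
rewrite tagnat.Rank1K.
by rewrite !ord1.
Qed.

(** The lasso matrices act on vectors that list, for each input channel in turn,
    its values at times 0, ..., q - 1. *)
Definition lasso_stack (R : realType) (m q : nat) (w : nat -> 'cV[R]_m)
    : 'cV[R]_(m * q) :=
  stack (fun i => \col_(j < q) w j i 0).

(** On an input that is constant from time tau on, closing the loop from time
    tau + lam back to time tau cannot be seen, so the lasso matrix acts as the
    shift of time. *)
Lemma lasso_P_stack (R : realType) (m tau lam : nat) (w : nat -> 'cV[R]_m) :
  (0 < lam)%N -> (forall t, (tau <= t)%N -> w t = w tau) ->
  lasso_P R m tau lam *m lasso_stack (tau + lam) w =
  lasso_stack (tau + lam) (fun t => w t.+1).
Proof.
move=> lam0 wtau; rewrite blkdiag_mul_stack.
congr stack; apply/funext => i; apply/matrixP => j k; rewrite !mxE.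
(* A row with a single 1, in column l, selects the l-th entry. *)
have sel (l : 'I_(tau + lam)) (b : 'I_(tau + lam) -> bool) :
    (forall l', b l' = (l' == l)) ->
    \sum_l' (b l')%:R * w l' i 0 = w l i 0.
  move=> bl; rewrite (bigD1 l) //= bl eqxx mul1r big1 ?addr0 // => l'.
  by rewrite bl => /negbTE ->; rewrite mul0r.
have [jq|qj] := ltnP j.+1 (tau + lam).
  by rewrite -(sel (Ordinal jq) (fun l => l == j.+1 :> nat)) //;
     apply: eq_bigr => l _; rewrite !mxE jq.
(* The last row reads time tau, where the shift asks for time tau + lam. *)
have tq : (tau < tau + lam)%N by rewrite -{1}(addn0 tau) ltn_add2l.
have tj : (tau <= j.+1)%N by rewrite (leq_trans (ltnW tq)).
rewrite wtau // -(sel (Ordinal tq) (fun l => l == tau :> nat)) //.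
by apply: eq_bigr => l _; rewrite !mxE ltnNge qj.
Qed.

Lemma lasso_H_stack (R : realType) (m tau lam : nat) (w : nat -> 'cV[R]_m) :
  (0 < lam)%N -> lasso_H R m tau lam *m lasso_stack (tau + lam) w = w 0%N.
Proof.
move=> lam0.
have castmx_mull a b d a' (ea : a = a') (X : 'M[R]_(a, b)) (Y : 'M[R]_(b, d)) :
    castmx (ea, erefl) X *m Y = castmx (ea, erefl) (X *m Y).
  by case: a' / ea; rewrite !castmx_id.
rewrite castmx_mull blkdiag_mul_stack; apply/colP => i.
have q0 : (0 < tau + lam)%N by rewrite addn_gt0 lam0 orbT.
rewrite stack_unitE !mxE (bigD1 (Ordinal q0)) //= !mxE eqxx mul1r.
rewrite big1 ?addr0 //.
move=> j j0; rewrite !mxE; case: eqP => [j0'|]; last by rewrite mul0r.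
by rewrite -val_eqE /= j0' in j0.
Qed.

Lemma lasso_input_stack (R : realType) (m tau lam : nat) (w : nat -> 'cV[R]_m)
    (t : nat) :
  (0 < lam)%N -> (forall t, (tau <= t)%N -> w t = w tau) ->
  lasso_input (lasso_stack (tau + lam) w) t = w t.
Proof.
move=> lam0; rewrite /lasso_input; elim: t w => [|t IH] w wtau.
  by rewrite expr0 mulmx1 lasso_H_stack.
rewrite exprSr -[lasso_P _ _ _ _ ^+ t * _]/(_ *m _) mulmxA -mulmxA.
rewrite lasso_P_stack // IH // => s taus.
by rewrite wtau ?(wtau tau.+1) // leqW.
Qed.

(** * Fading an admissible input into the fixed point *)

(** The error of a faded trajectory is a trajectory of A that starts at 0 and is
    driven by an additive forcing, so that its input matrix is the identity. *)
Lemma trajectory_mx1_sum (R : realType) (n : nat) (A : 'M[R]_n)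
    (d : nat -> 'cV[R]_n) (t : nat) :
  trajectory A 1%:M 0 d t = \sum_(j < t) A ^+ j *m d (t - j.+1)%N.
Proof.
elim: t => [|t IH] /=; first by rewrite big_ord0.
rewrite IH big_ord_recl expr0 subn1 addrC; congr (_ + _).
rewrite mulmx_sumr; apply: eq_bigr => j _.
by rewrite exprS mulmxA.
Qed.

Definition bounded_gain (R : realType) (n : nat) (A : 'M[R]_n) (L : R) : Prop :=
  forall (d : nat -> 'cV[R]_n) (b : R) (t : nat),
    0 <= b -> (forall s, (s < t)%N -> `|d s| <= b) ->
    `|trajectory A 1%:M 0 d t| <= L * b.

(** A forcing term is forgotten after k steps if A ^+ k = 0, so that at most k
    terms contribute at any time. *)
Lemma nilpotent_bounded_gain (R : realType) (n : nat) (A : 'M[R]_n) :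
  nilpotent_mx A ->
  exists2 L : R, 0 <= L & bounded_gain A L.
Proof.
case=> k Ak0; pose f j : R := n%:R * `|A ^+ j|.
have f0 j : 0 <= f j by rewrite mulr_ge0.
have fk j : (k <= j)%N -> f j = 0.
  by move=> kj; rewrite /f -(subnK kj) exprD Ak0 mulr0 normr0 mulr0.
exists (\sum_(j < k) f j) => [|d b t b0 db]; first exact: sumr_ge0.
rewrite trajectory_mx1_sum (le_trans (ler_norm_sum _ _ _)) //.
apply: (@le_trans _ _ ((\sum_(j < t) f j) * b)).
  rewrite mulr_suml; apply: ler_sum => j _.
  apply: le_trans (mx_norm_mulmx _ _) _; apply: ler_wpM2l => //; apply: db.
  by rewrite ltn_subrL /= (leq_trans _ (ltn_ord j)).
rewrite ler_wpM2r // (big_ord_widen _ f (leq_maxl t k)).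
rewrite (big_ord_widen _ f (leq_maxr t k)) [leRHS]big_mkcond [leLHS]big_mkcond.
apply: ler_sum => j _; case: ifP => _; case: ltnP => // kj.
by rewrite fk.
Qed.

Lemma polytope_convex (R : realType) (n : nat) (S : set 'cV[R]_n)
    (z w : 'cV[R]_n) (s : R) :
  polytope S -> S z -> S w -> 0 <= s -> s <= 1 -> S ((1 - s) *: z + s *: w).
Proof.
move=> [_ [k [G [f ->]]]] Gz Gw s0 s1 i /=.
have -> : f i 0 = (1 - s) * f i 0 + s * f i 0 by rewrite -mulrDl subrK mul1r.
rewrite mulmxDr -!scalemxAr.
rewrite [X in X <= _]mxE; apply: lerD; rewrite [X in X <= _]mxE;
  by apply: ler_wpM2l; rewrite // subr_ge0.
Qed.

(** With a constant weight the trajectory would be the combination of the two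
    given ones, by linearity; each change of the weight acts as a forcing along
    the direction of the next state. *)
Lemma trajectory_blend (R : realType) (n m : nat) (A : 'M[R]_n)
    (B : 'M[R]_(n, m)) (xe x : 'cV[R]_n) (ue : 'cV[R]_m)
    (u : nat -> 'cV[R]_m) (delta : nat -> R) (t : nat) :
  A *m xe + B *m ue = xe ->
  trajectory A B (xe + (1 - delta 0%N) *: (x - xe))
    (fun s => ue + (1 - delta s) *: (u s - ue)) t =
  xe + (1 - delta t) *: (trajectory A B x u t - xe) +
  trajectory A 1%:M 0 (fun s => (delta s.+1 - delta s) *:
    (trajectory A B x u s.+1 - xe)) t.
Proof.
move=> fix_e; elim: t => [|t IH] /=; first by rewrite addr0.
rewrite {}IH mul1mx.
have Axe : A *m xe = xe - B *m ue by rewrite -[X in _ = X - _]fix_e addrK.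
rewrite !mulmxDr -!scalemxAr !mulmxBr Axe.
set e := A *m trajectory _ _ _ _ _; set y := A *m _; set v := B *m u t.
by apply/matrixP => i j; rewrite !mxE; ring.
Qed.

(** The faded pair is (1 - p) (x_t, u_t) + p ((xe, ue) + (e / p, 0)) with
    p = delta_t and error e, and e / p has norm less than r. *)
Lemma admissible_blend (R : realType) (n m : nat) (A : 'M[R]_n)
    (B : 'M[R]_(n, m)) (S : set 'cV[R]_(n + m)) (xe x : 'cV[R]_n)
    (ue : 'cV[R]_m) (u : nat -> 'cV[R]_m) (delta : nat -> R) (r : R) :
  polytope S -> A *m xe + B *m ue = xe ->
  (forall w, `|w - col_mx xe ue| < r -> S w) ->
  admissible A B S x u ->
  (forall t, 0 < delta t <= 1) ->
  (forall t, `|trajectory A 1%:M 0 (fun s => (delta s.+1 - delta s) *: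
     (trajectory A B x u s.+1 - xe)) t| < r * delta t) ->
  admissible A B S (xe + (1 - delta 0%N) *: (x - xe))
    (fun s => ue + (1 - delta s) *: (u s - ue)).
Proof.
move=> polyS fix_e ballS xu delta01 err t; rewrite trajectory_blend //.
move: (err t) (delta01 t); set e := trajectory A _ _ _ _.
set p := delta t => ep /andP[p0 p1].
suff -> : col_mx (xe + (1 - p) *: (trajectory A B x u t - xe) + e)
      (ue + (1 - p) *: (u t - ue)) =
    (1 - p) *: col_mx (trajectory A B x u t) (u t) +
    p *: (col_mx xe ue + col_mx (p^-1 *: e) 0).
  apply: polytope_convex (ltW p0) p1 => //; apply: ballS.
  rewrite addrAC subrr add0r (le_lt_trans (norm_col_mx0 _ _)) //.
  by rewrite normrZ gtr0_norm ?invr_gt0 // mulrC ltr_pdivrMr.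
rewrite add_col_mx !scale_col_mx add_col_mx.
have pN0 : p != 0 by rewrite gt_eqF.
by congr col_mx; apply/matrixP => i j; rewrite !mxE; field.
Qed.

(** Each forcing term is at most (1 - a) a^(tau - (s + 1)) D, because each
    weight is at least a times the next one, and a^(tau - t) dominates the earlier
    weights. *)
Lemma norm_blend_error (R : realType) (n m : nat) (A : 'M[R]_n)
    (B : 'M[R]_(n, m)) (xe x : 'cV[R]_n) (u : nat -> 'cV[R]_m)
    (L D a : R) (tau t : nat) :
  bounded_gain A L ->
  0 <= D -> (forall s, `|trajectory A B x u s - xe| <= D) ->
  0 <= a <= 1 ->
  `|trajectory A 1%:M 0 (fun s => (a ^+ (tau - s.+1) - a ^+ (tau - s)) *:
     (trajectory A B x u s.+1 - xe)) t| <= L * ((1 - a) * D) * a ^+ (tau - t).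
Proof.
move=> gain D0 xD /andP[a0 a1]; rewrite -mulrA; apply: gain => [|s st].
  by rewrite !mulr_ge0 ?subr_ge0 ?exprn_ge0.
rewrite normrZ mulrAC; apply: ler_pM => //.
have mono i j : (i <= j)%N -> a ^+ j <= a ^+ i by exact: ler_wiXn2l.
rewrite ger0_norm; last by rewrite subr_ge0 mono // leq_sub2l.
apply: (@le_trans _ _ ((1 - a) * a ^+ (tau - s.+1))); last first.
  by apply: ler_wpM2l; rewrite ?subr_ge0 // mono // leq_sub2l.
rewrite mulrBl mul1r lerD2l lerN2 -exprS.
by apply: mono; lia.
Qed.

(** * Convergence of the lasso sets *)

Lemma lasso_Cx_eventually_constant (R : realType) (n m : nat) (A : 'M[R]_n)
    (B : 'M[R]_(n, m)) (Sxu : set 'cV[R]_(n + m)) (tau lam : nat)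
    (x : 'cV[R]_n) (u : nat -> 'cV[R]_m) :
  (0 < lam)%N -> (forall t, (tau <= t)%N -> u t = u tau) ->
  admissible A B Sxu x u -> lasso_Cx A B Sxu tau lam x.
Proof.
move=> lam0 utau xu; exists (col_mx x (lasso_stack (tau + lam) u)); last first.
  by rewrite col_mxKu.
rewrite /lasso_Cxv /= col_mxKu col_mxKd => t.
have -> : lasso_input (lasso_stack (tau + lam) u) = u.
  by apply/funext => s; exact: lasso_input_stack.
exact: xu.
Qed.

Lemma lasso_Cx_sub_max (R : realType) (n m : nat) (A : 'M[R]_n)
    (B : 'M[R]_(n, m)) (Sxu : set 'cV[R]_(n + m)) (tau lam : nat) :
  lasso_Cx A B Sxu tau lam `<=` max_controlled_invariant A B Sxu.
Proof.
move=> _ [z zC <-]; apply/max_controlled_invariantP.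
by exists (lasso_input (dsubmx z)).
Qed.

Lemma hausdorff_dist_le_subset (R : realType) (n : nat) (X Y : set 'cV[R]_n)
    (b : R) :
  0 <= b -> X `<=` Y ->
  (forall y, Y y -> exists2 x, X x & eucl_norm (x - y) <= b) ->
  (hausdorff_dist X Y <= b%:E)%E.
Proof.
move=> b0 XY near_X; rewrite /hausdorff_dist ge_max; apply/andP; split.
  apply: ge_ereal_sup => _ [x Xx <-].
  apply: (@le_trans _ _ (eucl_norm (x - x))%:E).
    by apply: ereal_inf_lbound; exists x => //; exact: XY.
  rewrite lee_fin /eucl_norm subrr big1 ?sqrtr0 // => i _.
  by rewrite mxE expr0n.
apply: ge_ereal_sup => _ [y Yy <-]; have [x Xx xy] := near_X y Yy.
apply: (@le_trans _ _ (eucl_norm (x - y))%:E); last by rewrite lee_fin.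
by apply: ereal_inf_lbound; exists x.
Qed.

Lemma polytope_norm_le (R : realType) (n : nat) (S : set 'cV[R]_n)
    (z0 : 'cV[R]_n) :
  polytope S -> exists2 D : R, 0 <= D & forall z, S z -> `|z - z0| <= D.
Proof.
move=> [[M [_ SM]] _]; exists (`|M| + 1 + `|z0|) => [|z Sz].
  by rewrite !addr_ge0.
rewrite (le_trans (ler_normB _ _)) // lerD2r.
by apply: SM Sz; rewrite (le_lt_trans (ler_norm M)) // ltrDl.
Qed.

Theorem corollary6p7 (R : realType) (n m : nat)
    (A : 'M[R]_n) (B : 'M[R]_(n, m)) (Sxu : set 'cV[R]_(n + m))
    (hA : nilpotent_mx A)
    (hS : polytope Sxu)
    (hfix : exists (x : 'cV[R]_n) (u : 'cV[R]_m),
        interior Sxu (col_mx x u) /\ A *m x + B *m u = x)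
    (lam : nat) (hlam : (0 < lam)%N) :
  exists (c a : R) (tau0 : nat),
    [/\ 0 < c, 0 < a, a < 1 &
        forall tau : nat, (tau0 <= tau)%N ->
          (hausdorff_dist (lasso_Cx A B Sxu tau lam)
             (max_controlled_invariant A B Sxu) <= (c * a ^+ tau)%:E)%E].
Proof.
case: hfix => xe [ue [/nbhs_ballP[r /= r0 ballS] fix_e]].
have {}ballS w : `|w - col_mx xe ue| < r -> Sxu w.
  by move=> wr; apply: ballS; rewrite mx_norm_ball /ball_ /= distrC.
have [L L0 gain] := nilpotent_bounded_gain hA.
have [D D0 SD] := polytope_norm_le (col_mx xe ue) hS.
(* Any eta = 1 - a in the open unit interval with L * (eta * D) < r will do;
   this one works also when L * D = 0. *)
pose eta := r / (2 * r + L * D + 1).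
have LD0 : 0 <= L * D by rewrite mulr_ge0.
have den0 : 0 < 2 * r + L * D + 1 by lra.
have eta0 : 0 < eta by rewrite divr_gt0.
have eta1 : eta < 1 by rewrite /eta ltr_pdivrMr //; lra.
have etaLD : L * (eta * D) < r.
  rewrite mulrCA /eta mulrAC ltr_pdivrMr // ltr_pM2l //; lra.
(* The added 1 keeps the constant positive when n = 0 or D = 0. *)
exists (n%:R * D + 1), (1 - eta), 0%N; split; [|lra|lra|move=> tau _].
  by rewrite ltr_wpDl // mulr_ge0.
set a := 1 - eta.
have a0 : 0 < a by rewrite /a; lra.
have a1 : a <= 1 by rewrite /a; lra.
apply: hausdorff_dist_le_subset; last move=> y /max_controlled_invariantP[u yu].
- by rewrite mulr_ge0 ?exprn_ge0 ?(ltW a0) // addr_ge0 // mulr_ge0.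
- exact: lasso_Cx_sub_max.
have xD s : `|trajectory A B y u s - xe| <= D.
  apply: le_trans (SD _ (yu s)).
  rewrite opp_col_mx add_col_mx -[X in `|X| <= _](col_mxKu _ (u s - ue)).
  exact: norm_usubmx.
exists (xe + (1 - a ^+ (tau - 0)) *: (y - xe)); last first.
  rewrite subn0.
  have -> : xe + (1 - a ^+ tau) *: (y - xe) - y = - a ^+ tau *: (y - xe).
    by apply/matrixP => i j; rewrite !mxE; ring.
  rewrite (le_trans (eucl_norm_le _)) // normrZ normrN.
  rewrite ger0_norm ?exprn_ge0 ?(ltW a0) //.
  rewrite mulrCA mulrC ler_wpM2r ?exprn_ge0 ?(ltW a0) //.
  by rewrite (le_trans (ler_wpM2l _ (xD 0%N))) // lerDl.
apply: (@lasso_Cx_eventually_constant _ _ _ _ _ _ _ _ _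
  (fun s => ue + (1 - a ^+ (tau - s)) *: (u s - ue))) => //.
  move=> t taut; suff -> : (tau - t = 0)%N.
    by rewrite subnn expr0 subrr !scale0r.
  by apply/eqP; rewrite subn_eq0.
apply: (admissible_blend (delta := fun s => a ^+ (tau - s)) hS fix_e ballS yu).
  by move=> t; rewrite exprn_gt0 // exprn_ile1 // ltW.
have a01 : 0 <= a <= 1 by rewrite (ltW a0).
move=> t; have := norm_blend_error tau t gain D0 xD a01.
move=> /le_lt_trans; apply; rewrite ltr_pM2r ?exprn_gt0 //.
by rewrite /a subKr.
Qed.
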